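(* For any integer $n\ge 2$ we have $$\mathcal{E}_{[n,1,2,\ldots,n-1]}(t)=\mathcal{E}_{[2,3,\ldots,n,1]}(t)=p_{n-1}(t).$$
   Context: Permutations $\sigma\in\mathfrak{S}_n$ are written in one-line notation $[\sigma(1),\ldots,\sigma(n)]$. For $1\le i\le n-1$, $s_i$ is the simple transposition $(i,i+1)$; products are read from left to right, so that $\sigma s_i$ interchanges the entries of $\sigma$ in positions $i$ and $i+1$. Thus $[2,3,\ldots,n,1]=s_1s_2\cdots s_{n-1}$ and $[n,1,2,\ldots,n-1]=s_{n-1}s_{n-2}\cdots s_1$. $\ell(\sigma)$ is the number of inversions of $\sigma$. The isobaric divided difference $\pi_i$ acts on a function $F(\mathbf{x})$ of $\mathbf{x}=(x_1,\ldots,x_n)$ by $$\pi_iF(\mathbf{x})=\frac{x_iF(x_1,\ldots,x_i,x_{i+1},\ldots,x_n)-x_{i+1}F(x_1,\ldots,x_{i+1},x_i,\ldots,x_n)}{x_i-x_{i+1}}.$$ For a reduced decomposition $\sigma=s_{i_1}\cdots s_{i_\ell}$ put $\pi_\sigma=\pi_{i_1}\cdots\pi_{i_\ell}$ (composition of operators, the rightmost applied first; independent of the reduced decomposition). For a partition $\lambda=(\lambda_1\ge\cdots\ge\lambda_n\ge 0)$ the key polynomial is $\kappa_{\lambda,\sigma}(\mathbf{x})=\pi_\sigma(x_1^{\lambda_1}\cdots x_n^{\lambda_n})$, and $j\lambda=(j\lambda_1,\ldots,j\lambda_n)$. Let $\delta_n=(n-1,n-2,\ldots,1,0)$. The polynomial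 $\mathcal{E}_\sigma(t)$ is the numerator in $$\sum_{j\ge 0}\kappa_{j\delta_n,\sigma}(1,\ldots,1)\,t^j=\frac{\mathcal{E}_\sigma(t)}{(1-t)^{\ell(\sigma)+1}}.$$ A parking function of length $n$ is a sequence $\mathbf{a}=(a_1,\ldots,a_n)$ of positive integers whose non-decreasing rearrangement $(b_1,\ldots,b_n)$ satisfies $b_i\le i$ for all $1\le i\le n$. $\mathcal{PF}_n$ is the set of these, $\mathrm{des}(\mathbf{a})$ is the number of $1\le i\le n-1$ with $a_i>a_{i+1}$, and $p_n(t)=\sum_{\mathbf{a}\in\mathcal{PF}_n}t^{\,n-1-\mathrm{des}(\mathbf{a})}$. *)

(* Defs.v *)
From HB Require Import structures.
From mathcomp Require Import all_boot all_order all_algebra all_fingroup.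
From mathcomp Require Import mpoly.
From mathcomp Require Import zify ring.

Set Implicit Arguments.
Unset Strict Implicit.
Unset Printing Implicit Defensive.

Import GRing.Theory.
Local Open Scope ring_scope.

(* Positions, variables and simple transpositions are indexed from 0, so that
   [simple i] with i : 'I_n.-1 is the transposition s_(i+1) of the usual
   1-based indexing. *)

Section Permutations.

Variable n : nat.
Implicit Types (i : 'I_n.-1) (sigma : 'S_n).

Lemma pos_subproof i : (i < n)%N.
Proof. by have := ltn_ord i; lia. Qed.

Lemma posS_subproof i : (i.+1 < n)%N.
Proof. by have := ltn_ord i; lia. Qed.

Definition pos i : 'I_n := Ordinal (pos_subproof i).
Definition posS i : 'I_n := Ordinal (posS_subproof i).

Definition simple i : 'S_n := tperm (pos i) (posS i).

Definition inversions sigma : {set 'I_n * 'I_n} :=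
  [set p : 'I_n * 'I_n | (p.1 < p.2)%N && (sigma p.2 < sigma p.1)%N].

Definition perm_length sigma : nat := #|inversions sigma|.

(* MathComp composes permutations from left to right, (s * t) x = t (s x), so
   [simple i * sigma] is sigma with the entries in positions i and i+1 of its
   one-line notation interchanged, which is sigma s_i for the convention
   [2,3,...,n,1] = s_1 s_2 ... s_(n-1). *)
Definition mul_simple sigma i : 'S_n := (simple i * sigma)%g.

Definition word_perm (w : seq 'I_n.-1) : 'S_n := foldl mul_simple 1%g w.

Definition is_reduced sigma (w : seq 'I_n.-1) : bool :=
  (word_perm w == sigma) && (size w == perm_length sigma).

Lemma mul_simpleK i : involutive (mul_simple^~ i).
Proof. by move=> sigma; rewrite /mul_simple /simple mulgA tperm2 mul1g. Qed.

Lemma simple_lt i (x y : 'I_n) : (x < y)%N -> (x, y) != (pos i, posS i) ->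
  (simple i x < simple i y)%N.
Proof.
move=> lt_xy; rewrite xpair_eqE -!val_eqE /= => nexy.
rewrite /simple !permE /= -!val_eqE /=.
by do ![case: ifP => /=]; lia.
Qed.

Lemma length_descent i sigma : (sigma (posS i) < sigma (pos i))%N ->
  perm_length sigma = (perm_length (mul_simple sigma i)).+1.
Proof.
move=> desc; set s := simple i; set tau := mul_simple sigma i.
have sK x : s (s x) = x by rewrite /s /simple tpermK.
have tauE x : tau x = sigma (s x) by rewrite /tau /mul_simple permM.
pose f (p : 'I_n * 'I_n) := (s p.1, s p.2).
have fK : cancel f f by case=> x y; rewrite /f /= !sK.
have mem0 : (pos i, posS i) \in inversions sigma by rewrite inE /= ltnSn.
rewrite /perm_length (cardsD1 (pos i, posS i)) mem0 add1n; congr _.+1.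
rewrite -(card_imset _ (can_inj fK)); apply: eq_card => -[x y].
apply/imsetP/idP => [[[a b]]|].
  rewrite 3!inE /= => /andP[ne /andP[lt_ab inv_ab]] [-> ->].
  by rewrite inE /= !tauE !sK inv_ab andbT simple_lt.
rewrite inE /= !tauE => /andP[lt_xy inv_xy].
have ne : (x, y) != (pos i, posS i).
  apply: contraTneq inv_xy => -[-> ->].
  by rewrite /s /simple tpermL tpermR -leqNgt ltnW.
exists (s x, s y); last by rewrite /f /= !sK.
rewrite 3!inE /= inv_xy simple_lt // !andbT.
apply: contraTneq lt_xy => -[/(congr1 s) + /(congr1 s)].
by rewrite !sK /s /simple tpermL tpermR => -> -> /=; lia.
Qed.

Lemma no_descent_id sigma :
  (forall i, ~~ (sigma (posS i) < sigma (pos i))%N) -> sigma = 1%g.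
Proof.
move=> nodesc.
have step (k : nat) (h : (k < n)%N) (h' : (k.+1 < n)%N) :
    (sigma (Ordinal h) < sigma (Ordinal h'))%N.
  have hk : (k < n.-1)%N by lia.
  have := nodesc (Ordinal hk); rewrite -leqNgt leq_eqVlt.
  have -> : pos (Ordinal hk) = Ordinal h by apply: val_inj.
  have -> : posS (Ordinal hk) = Ordinal h' by apply: val_inj.
  by case/orP => // /eqP /val_inj /perm_inj /(congr1 val) /=; lia.
have lower (k : nat) : forall h : (k < n)%N, (k <= sigma (Ordinal h))%N.
  elim: k => // k IHk h.
  have hk : (k < n)%N by lia.
  by have := step k hk h; have := IHk hk; lia.
have upper (d k : nat) : forall h : (k < n)%N, (d + k = n.-1)%N ->
    (sigma (Ordinal h) <= k)%N.
  elim: d k => [|d IHd] k h dk; first by have := ltn_ord (sigma (Ordinal h)); lia.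
  have hk : (k.+1 < n)%N by lia.
  have dk' : (d + k.+1 = n.-1)%N by lia.
  by have := step k h hk; have := IHd k.+1 hk dk'; lia.
apply/permP => -[k h]; rewrite perm1; apply: val_inj => /=.
have dk : (n.-1 - k + k = n.-1)%N by lia.
by have := lower k h; have := upper _ k h dk; lia.
Qed.

Lemma reduced_exists sigma : exists w, is_reduced sigma w.
Proof.
move: {2}(perm_length sigma) (erefl (perm_length sigma)) => l.
elim: l sigma => [|l IHl] sigma len.
  exists [::]; rewrite /is_reduced len eqxx andbT eq_sym; apply/eqP.
  apply: no_descent_id => i; apply/negP => /length_descent.
  by rewrite len.
have [i desc|nodesc] := pickP (fun i => sigma (posS i) < sigma (pos i))%N.
  have := length_descent desc; rewrite len => -[len'].
  have [w /andP[/eqP w1 /eqP w2]] := IHl _ (esym len').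
  exists (rcons w i); rewrite /is_reduced size_rcons w2 len -len' eqxx andbT.
  by rewrite /word_perm foldl_rcons -/(word_perm w) w1 mul_simpleK.
have s1 : sigma = 1%g by apply: no_descent_id => i; rewrite nodesc.
have : perm_length sigma = 0.
  apply: eq_card0 => -[x y]; rewrite inE s1 !perm1 /=.
  by apply/negP => /andP[]; lia.
by rewrite len.
Qed.

Definition reduced_word sigma : seq 'I_n.-1 := xchoose (reduced_exists sigma).

Lemma reduced_wordP sigma : is_reduced sigma (reduced_word sigma).
Proof. exact: xchooseP. Qed.

End Permutations.

(* [2, 3, ..., n, 1] and [n, 1, 2, ..., n-1]; [ordS] and [ord_pred] are the
   cyclic successor and predecessor on 'I_n. *)
Definition cycle_up (n : nat) : 'S_n := perm (@ordS_inj n).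
Definition cycle_down (n : nat) : 'S_n := perm (@ord_pred_inj n).

Section KeyPolynomials.

Variable n : nat.
Implicit Types (i : 'I_n.-1) (F G : {mpoly int[n]}) (sigma : 'S_n).

(* [msym s F] is F with 'X_k replaced by 'X_(s k). *)
Definition pi_numerator i F : {mpoly int[n]} :=
  'X_(pos i) * F - 'X_(posS i) * msym (simple i) F.

Definition is_pi i F G : bool :=
  ('X_(pos i) - 'X_(posS i)) * G == pi_numerator i F.

Lemma pi_exists i F : exists G, is_pi i F G.
Proof.
pose x : {mpoly int[n]} := 'X_(pos i); pose y : {mpoly int[n]} := 'X_(posS i).
pose s := simple i.
suff [H HE] : exists H, F - msym s F = (x - y) * H.
  exists (F + y * H); apply/eqP; rewrite /pi_numerator -/x -/y -/s mulrDr.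
  by rewrite (mulrCA (x - y)) -HE; ring.
have divM P Q : (exists H, P - msym s P = (x - y) * H) ->
    (exists H, Q - msym s Q = (x - y) * H) ->
    exists H, P * Q - msym s (P * Q) = (x - y) * H.
  move=> [H1 E1] [H2 E2]; exists (H1 * Q + msym s P * H2).
  rewrite mulrDr mulrA -E1 mulrCA -E2 msymM; ring.
have div1 : exists H, (1 : {mpoly int[n]}) - msym s 1 = (x - y) * H.
  by exists 0; rewrite msym1 subrr mulr0.
have divX k : exists H, ('X_k : {mpoly int[n]}) - msym s 'X_k = (x - y) * H.
  have -> : msym s ('X_k : {mpoly int[n]}) = 'X_(s k).
    rewrite msymX; congr mpolyX; apply/mnmP => j; rewrite !mnmE.
    have -> : (s^-1)%g = s by rewrite /s /simple tpermV.
    by rewrite -[in RHS](inj_eq (@perm_inj _ s)) /s /simple tpermK.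
  rewrite /s /simple; case: tpermP => [->|->|_ _].
  - by exists 1; rewrite mulr1.
  - by exists (- 1); rewrite mulrN1 opprB.
  - by exists 0; rewrite subrr mulr0.
elim/mpolyind: F => [|c m p _ _ [H HE]].
  by exists 0; rewrite msym0 subrr mulr0.
have [K KE] : exists K, ('X_[m] : {mpoly int[n]}) - msym s 'X_[m] = (x - y) * K.
  rewrite mpolyXE_id.
  elim/big_ind: _ => // j _; elim: (m j) => [|e IHe]; first by rewrite expr0.
  by rewrite exprS; apply: divM.
exists (c *: K + H); rewrite msymD msymZ mulrDr -scalerAr -KE -HE scalerBr.
by ring.
Qed.

(* The isobaric divided difference; the quotient of polynomials is exact. *)
Definition pi i F : {mpoly int[n]} := xchoose (pi_exists i F).

Lemma piP i F :
  ('X_(pos i) - 'X_(posS i)) * pi i F =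
    'X_(pos i) * F - 'X_(posS i) * msym (simple i) F.
Proof. by apply/eqP; exact: (xchooseP (pi_exists i F)). Qed.

Lemma pi_unique i F G :
  ('X_(pos i) - 'X_(posS i)) * G =
    'X_(pos i) * F - 'X_(posS i) * msym (simple i) F -> G = pi i F.
Proof.
rewrite -piP; apply: mulfI; rewrite subr_eq0; apply/eqP.
move/(congr1 (mcoeff U_(pos i))); rewrite !mcoeffX eqxx.
case: eqP => // /mnmP /(_ (posS i)); rewrite !mnmE eqxx -val_eqE /=; lia.
Qed.

(* For w = [:: i_1; ...; i_l] the operator pi_(i_l) is applied first. *)
Definition pi_word (w : seq 'I_n.-1) F : {mpoly int[n]} := foldr pi F w.

Definition pi_perm sigma F : {mpoly int[n]} := pi_word (reduced_word sigma) F.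

Definition key (lambda : 'X_{1..n}) sigma : {mpoly int[n]} :=
  pi_perm sigma 'X_[lambda].

Definition delta : 'X_{1..n} := [multinom (n.-1 - i)%N | i < n].

Definition key_at_ones sigma (j : nat) : int :=
  (key (delta *+ j)%MM sigma).@[fun=> 1].

End KeyPolynomials.

(* As formal power series, \sum_(j >= 0) a j t^j = P(t) / (1 - t)^d; this is
   the identity (1 - t)^d * \sum_(j >= 0) a j t^j = P(t), coefficientwise. *)
Definition is_numerator (a : nat -> int) (d : nat) (P : {poly int}) : Prop :=
  forall k, \sum_(i < k.+1) ((1 - 'X) ^+ d)`_i * a (k - i)%N = P`_k.

Definition is_E (n : nat) (sigma : 'S_n) (P : {poly int}) : Prop :=
  is_numerator (key_at_ones sigma) (perm_length sigma).+1 P.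

Lemma is_E_unique n (sigma : 'S_n) P Q : is_E sigma P -> is_E sigma Q -> P = Q.
Proof. by move=> hP hQ; apply/polyP => k; rewrite -hP -hQ. Qed.

Definition is_parking (a : seq nat) : bool :=
  all (leq 1) a &&
  all (fun i => nth 0%N (sort leq a) i <= i.+1)%N (iota 0 (size a)).

Definition des (a : seq nat) : nat :=
  count (fun i => nth 0%N a i.+1 < nth 0%N a i)%N (iota 0 (size a).-1).

Lemma parking_le_size a : is_parking a -> all (leq^~ (size a)) a.
Proof.
case/andP=> _ /allP h; apply/allP => x; rewrite -(mem_sort leq) => xa.
have lt_x : (index x (sort leq a) < size a)%N by rewrite -(size_sort leq) index_mem.
have := h (index x (sort leq a)); rewrite mem_iota nth_index //= => /(_ lt_x).
by move=> /leq_trans; apply.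
Qed.

(* Entries range over {0, ..., n}, which loses no parking function of length n
   by [parking_le_size]. *)
Definition PF (n : nat) : {set n.-tuple 'I_n.+1} :=
  [set a : n.-tuple 'I_n.+1 | is_parking (map val a)].

Definition parking_poly (n : nat) : {poly int} :=
  \sum_(a in PF n) 'X^(n.-1 - des (map val a)).

(* Main.v *)
(* In one-line notation every prefix of s_1 ... s_(n-1), and of
   s_(n-1) ... s_1, has a single descent, so each cycle has only one reduced
   word.  Applying the operators one after the other to the monomial of
   j * delta expands it into monomials, and both values at (1, ..., 1) are the
   number of sequences (c_1, ..., c_(n-1)) with 0 <= c_1 <= j and
   0 <= c_(i+1) <= j + c_i.

   With m = n - 1, these sequences encode the m-element subsets
   of {0, ..., j} x {1, ..., m} that have at least i elements with second
   coordinate at most i, for all i: list the subset by increasing second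
   coordinate, and c_i is the slack in the position of the i-th element.
   Listing the same subset by increasing first coordinate, ties broken by
   decreasing second coordinate, the second coordinates form a parking function
   a, and for fixed a the first coordinates are weakly increasing, strictly so
   at the non-descents of a: this leaves C(j + 1 + des a, m) possibilities.
   Finally,
   \sum_j C(j + 1 + des a, m) t^j = t^(m - 1 - des a) / (1 - t)^(m + 1). *)
Require Import Defs.
From mathcomp Require Import all_boot all_order all_algebra all_fingroup.
From mathcomp Require Import mpoly.
From mathcomp Require Import zify ring.
(* The name [pi] is shadowed by all_algebra. *)
Import Defs.

Set Implicit Arguments.
Unset Strict Implicit.
Unset Printing Implicit Defensive.

Import GRing.Theory.
Local Open Scope ring_scope.

(** * Reduced words of the two cycles *)

Section ReducedWords.

Variable n : nat.
Implicit Types (i : 'I_n.-1) (sigma : 'S_n) (w u : seq 'I_n.-1).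

Definition descent sigma i : bool := (sigma (posS i) < sigma (pos i))%N.

Lemma mul_simple_pos sigma i : mul_simple sigma i (pos i) = sigma (posS i).
Proof. by rewrite /mul_simple permM /simple tpermL. Qed.

Lemma mul_simple_posS sigma i : mul_simple sigma i (posS i) = sigma (pos i).
Proof. by rewrite /mul_simple permM /simple tpermR. Qed.

Lemma length_ascent sigma i : ~~ descent sigma i ->
  perm_length (mul_simple sigma i) = (perm_length sigma).+1.
Proof.
rewrite /descent -leqNgt leq_eqVlt => /orP[/eqP/val_inj/perm_inj/(congr1 val)|lt].
  by move=> /=; lia.
rewrite (@length_descent _ i) ?mul_simpleK //.
by rewrite mul_simple_pos mul_simple_posS.
Qed.

Lemma word_perm_rcons w i : word_perm (rcons w i) = mul_simple (word_perm w) i.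
Proof. by rewrite /word_perm foldl_rcons. Qed.

Lemma length_word_perm w : (perm_length (word_perm w) <= size w)%N.
Proof.
elim/last_ind: w => [|w i IHw].
  rewrite leqn0; apply/eqP/eq_card0 => -[x y]; rewrite inE !perm1 /=.
  by apply/negP => /andP[]; lia.
rewrite word_perm_rcons size_rcons.
have [/length_descent|/length_ascent] := boolP (descent (word_perm w) i); lia.
Qed.

(** If [i] were an ascent of [sigma], the permutation of [w] would have length [size w + 2], more
    than its number of letters. *)
Lemma reduced_descent sigma w i : is_reduced sigma (rcons w i) ->
  descent sigma i.
Proof.
case/andP => /eqP <- /eqP; rewrite word_perm_rcons size_rcons => len.
apply: contraT => /length_ascent; rewrite mul_simpleK -len.
by have := length_word_perm w; lia.
Qed.

Definition single_descents u : Prop :=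
  forall u1 i u2 i', u = rcons u1 i ++ u2 ->
    descent (word_perm (rcons u1 i)) i' = (i' == i).

(** The last letter of a reduced word is a descent of its permutation, so it must be the last letter
    of [u]; cancel it on both sides and recurse on the prefix. *)
Lemma reduced_single_descents u w : single_descents u ->
  is_reduced (word_perm u) w -> w = u.
Proof.
elim/last_ind: u w => [|u i IHu] w sd.
  case/andP => _ /eqP; have := length_word_perm [::] => /=.
  by rewrite leqn0 => /eqP -> /size0nil.
have sdE i' : descent (word_perm (rcons u i)) i' = (i' == i).
  by apply: (sd u i [::]); rewrite cats0.
case/lastP: w => [|w i'] red.
  have := sdE i; rewrite eqxx; case/andP: red => /eqP <- _.
  by rewrite /descent !perm1 /=; lia.
have := reduced_descent red; rewrite sdE => /eqP ii'; subst i'.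
have desc : descent (word_perm (rcons u i)) i by rewrite sdE.
case/andP: red => /eqP red1 /eqP red2; congr rcons; apply: IHu.
  move=> u1 k u2 k' eq_u; apply: (sd u1 k (rcons u2 i)).
  by rewrite eq_u rcons_cat.
apply/andP; split.
  by move: red1; rewrite !word_perm_rcons => /(can_inj (@mul_simpleK _ i)) ->.
move: red2; rewrite (length_descent desc) size_rcons word_perm_rcons mul_simpleK.
by case=> ->.
Qed.

Lemma reduced_word_single_descents sigma u : single_descents u ->
  word_perm u = sigma -> reduced_word sigma = u /\ perm_length sigma = size u.
Proof.
move=> sd eq_u; have red := reduced_wordP sigma.
have eq_w : reduced_word sigma = u.
  by apply: reduced_single_descents => //; rewrite eq_u.
by split=> //; case/andP: red => _ /eqP <-; rewrite eq_w.
Qed.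

Lemma val_simple i (x : 'I_n) :
  simple i x = (if x == i :> nat then i.+1 else if x == i.+1 :> nat then i : nat
    else x) :> nat.
Proof.
rewrite /simple permE /= -!val_eqE /=.
by case: ifP => //= _; case: ifP.
Qed.

Lemma word_perm_up w k (x : 'I_n) : map val w = iota 0 k -> 
  word_perm w x = (if x < k then x.+1 else if x == k :> nat then 0
    else x)%N :> nat.
Proof.
elim/last_ind: w k x => [|w i IHw] [|k] x //.
- by move=> _; rewrite perm1 /=; case: eqP.
- by move/(congr1 size); rewrite size_map size_rcons.
rewrite -addn1 iotaD cats1 map_rcons add0n => /rcons_inj[eq_w eq_i].
rewrite word_perm_rcons /mul_simple permM (IHw _ _ eq_w) val_simple.
by do ![case: ifP => /=]; lia.
Qed.

(** Each letter carries the largest entry one place to the left, the others keeping their order. The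
    last letter is [p], so induction on [r] drops it and raises [p]. *)
Lemma word_perm_down w p r (x : 'I_n) : map val w = rev (iota p r) ->
  (p + r = n.-1)%N ->
  word_perm w x = (if x < p then x : nat else if x == p :> nat then n.-1
    else x.-1)%N :> nat.
Proof.
have := ltn_ord x => ltx.
elim/last_ind: w p r x ltx => [|w i IHw] p [|r] x ltx //.
- by move=> _ pr; rewrite perm1 /=; do ![case: ifP => /=]; lia.
- by move/(congr1 size); rewrite size_rev size_iota.
- by move/(congr1 size); rewrite size_map size_rcons.
rewrite /= rev_cons map_rcons => /rcons_inj[eq_w eq_i] pr.
rewrite word_perm_rcons /mul_simple permM.
rewrite (IHw p.+1 r) ?ltn_ord //; last lia.
rewrite val_simple.
by do ![case: ifP => /=]; lia.
Qed.

Lemma iota_split (T : Type) (f : T -> nat) (u1 u2 : seq T) (i : T) p r :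
  map f (rcons u1 i ++ u2) = iota p r ->
  map f (rcons u1 i) = iota p (size u1).+1 /\ f i = (p + size u1)%N.
Proof.
rewrite map_cat => eq_u.
have eq1 : map f (rcons u1 i) = iota p (size u1).+1.
  have := congr1 (take (size u1).+1) eq_u.
  rewrite take_size_cat ?size_map ?size_rcons // => ->.
  rewrite take_iota; congr iota; apply/minn_idPl.
  by have := congr1 size eq_u; rewrite size_cat size_map size_rcons size_iota; lia.
split=> //; move: eq1; rewrite -addn1 iotaD cats1 map_rcons.
by case/rcons_inj.
Qed.

Lemma single_descents_up w k : map val w = iota 0 k -> single_descents w.
Proof.
move=> eq_w u1 i u2 i' eq_u; move: eq_w; rewrite eq_u => eq_w.
have [eq1 eq2] := iota_split eq_w.
rewrite /descent !(word_perm_up _ eq1) -val_eqE /=.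
move: eq2 => /=.
by have := ltn_ord i'; do ![case: ifP => /=]; lia.
Qed.

Lemma single_descents_down w : map val w = rev (iota 0 n.-1) ->
  single_descents w.
Proof.
move=> eq_w u1 i u2 i' eq_u; move: eq_w; rewrite eq_u => eq_w.
have sz : (size u1 < n.-1)%N.
  have := congr1 size eq_w.
  by rewrite size_map size_cat size_rcons size_rev size_iota => /=; lia.
have eq1 : map val (rcons u1 i) =
    rev (iota (n.-1 - (size u1).+1) (size u1).+1).
  have := congr1 (take (size u1).+1) eq_w.
  rewrite map_cat take_size_cat ?size_map ?size_rcons // => ->.
  by rewrite take_rev size_iota drop_iota; congr (rev (iota _ _)); lia.
have eq2 : val i = (n.-1 - (size u1).+1)%N.
  by move: eq1; rewrite /= rev_cons map_rcons => /rcons_inj[].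
rewrite /descent !(word_perm_down _ eq1); try lia.
rewrite -val_eqE /=; move: eq2 => /=; have := ltn_ord i'.
by do ![case: ifP => /=]; lia.
Qed.

End ReducedWords.

Lemma reduced_word_cycle_up n : (0 < n)%N ->
  map val (reduced_word (cycle_up n)) = iota 0 n.-1 /\
  perm_length (cycle_up n) = n.-1.
Proof.
move=> n_gt0; have eq_w := val_enum_ord n.-1.
have sd := single_descents_up eq_w.
have [|-> ->] := reduced_word_single_descents (sigma := cycle_up n) sd.
  apply/permP => x; apply: val_inj => /=; rewrite (word_perm_up _ eq_w) permE /=.
  have ltxn := ltn_ord x; case: ltnP => ltx.
    by rewrite modn_small //; lia.
  have -> : x = n.-1 :> nat by lia.
  by rewrite eqxx prednK // modnn.
by rewrite eq_w size_enum_ord.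
Qed.

Lemma reduced_word_cycle_down n : (0 < n)%N ->
  map val (reduced_word (cycle_down n)) = rev (iota 0 n.-1) /\
  perm_length (cycle_down n) = n.-1.
Proof.
move=> n_gt0.
have eq_w : map val (rev (enum 'I_n.-1)) = rev (iota 0 n.-1).
  by rewrite map_rev val_enum_ord.
have sd := single_descents_down eq_w.
have [|-> ->] := reduced_word_single_descents (sigma := cycle_down n) sd.
  apply/permP => x; apply: val_inj => /=; rewrite (word_perm_down _ eq_w) // permE /=.
  have ltxn := ltn_ord x; case: eqP => [->|ltx] /=.
    by rewrite add0n modn_small //; lia.
  have -> : ((x + n).-1 = x.-1 + n)%N by lia.
  by rewrite modnDr modn_small //; lia.
by rewrite eq_w size_rev size_enum_ord.
Qed.

(** The number of sequences c_1, ..., c_r with 0 <= c_(i+1) <= j + c_i, where c_0 = c. *)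
Fixpoint slack_count (j r c : nat) : nat :=
  if r is r'.+1 then \sum_(k < (j + c).+1) slack_count j r' k else 1.

(** * Key polynomials at (1, ..., 1) *)

Section DividedDifferences.

Variable n : nat.
Implicit Types (i : 'I_n.-1) (F : {mpoly int[n]}) (w : seq 'I_n.-1).
Implicit Types (f : nat -> nat).

Lemma pi0 i : pi i 0 = 0.
Proof. by apply/esym/pi_unique; rewrite msym0 !mulr0 subrr. Qed.

Lemma piD i : {morph pi i : F G / F + G}.
Proof.
move=> F G; apply/esym/pi_unique; rewrite mulrDr !piP msymD; ring.
Qed.

Lemma pi_word_sum w r (F : 'I_r -> {mpoly int[n]}) :
  pi_word w (\sum_k F k) = \sum_k pi_word w (F k).
Proof.
elim: w => [//|i w IHw]; rewrite /= -/(pi_word _ _) IHw.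
exact: (big_morph _ (piD i) (pi0 i)).
Qed.

Definition expnt f : 'X_{1..n} := [multinom f i | i < n].

Definition transfer f (p k : nat) : nat -> nat :=
  fun x => (if x == p then f p - k else if x == p.+1 then f p.+1 + k else f x)%N.

(** A geometric sum: the terms satisfy y g_k = x g_(k+1), so (x - y) times their sum telescopes to x
    g_0 - y g_d, where g_0 is the given monomial and g_d its image under the transposition. *)
Lemma pi_monomial i f d : (f i = f i.+1 + d)%N ->
  pi i 'X_[expnt f] = \sum_(k < d.+1) 'X_[expnt (transfer f i k)].
Proof.
move=> fi; apply/esym/pi_unique.
pose x : {mpoly int[n]} := 'X_(pos i); pose y : {mpoly int[n]} := 'X_(posS i).
pose g k : {mpoly int[n]} := 'X_[expnt (transfer f i k)].
have step k : (k < d)%N -> y * g k = x * g k.+1.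
  move=> lt_k; rewrite /x /y /g -!mpolyXD; congr mpolyX; apply/mnmP => z.
  rewrite !mnmE /transfer -!val_eqE /=.
  by do ![case: eqP => //=]; lia.
have tele e : (e <= d)%N ->
    (x - y) * (\sum_(k < e.+1) g k) = x * g 0%N - y * g e.
  elim: e => [|e IHe] le_e; first by rewrite big_ord1 mulrBl.
  rewrite big_ord_recr mulrDr IHe 1?ltnW // step //=; ring.
have := tele d (leqnn d); rewrite /x /y /g => ->.
congr (_ * _ - _ * _); first congr mpolyX.
  apply/mnmP => z; rewrite !mnmE /transfer.
  by case: eqP => [->|_]; [|case: eqP => [->|_]]; lia.
rewrite msymX; congr mpolyX; apply/mnmP => z; rewrite !mnmE.
rewrite /simple tpermV -/(simple i) val_simple /transfer.
by case: eqP => [_|_]; [|case: eqP => [_|_]]; lia.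
Qed.

(** The letter [p] acts first. Consecutive exponents differ by j, with an excess c at [p]. Moving k
    units from [p] to [p.+1] makes the next gap j + k, so k is the new excess for the remaining
    letters, all larger than [p]. *)
Lemma pi_word_down (j r p c : nat) w f : map val w = rev (iota p r) ->
  (forall x, p <= x < p + r -> f x = f x.+1 + (j + c * (x == p)))%N ->
  (pi_word w 'X_[expnt f]).@[fun=> 1] = (slack_count j r c)%:Z.
Proof.
elim: r p c w f => [|r IHr] p c w f.
  case: w => // _ _; rewrite /= mevalX big1 // => x _; exact: expr1n.
rewrite /= rev_cons; case/lastP: w => [|w i].
  by move/(congr1 size); rewrite size_rcons.
rewrite map_rcons => /rcons_inj[eq_w eq_i] fE.
rewrite /pi_word foldr_rcons -/(pi_word _ _) (@pi_monomial _ _ (j + c));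
  last first.
  by rewrite eq_i fE ?eqxx; lia.
rewrite pi_word_sum raddf_sum /= (big_morph Posz PoszD (erefl 0%:Z)).
apply: eq_bigr => k _; apply: (IHr p.+1) => // x hx; rewrite /transfer eq_i.
have ltk := ltn_ord k.
have -> : (x == p) = false by lia.
have -> : (x.+1 == p) = false by lia.
have -> : (x.+1 == p.+1) = false by lia.
case: (x =P p.+1) => [->|ne_x]; rewrite fE; lia.
Qed.

(** Mirror image of [pi_word_down]: the largest letter acts first, and taking k units away from its
    position widens the gap just before it to j + k. *)
Lemma pi_word_up (j r p c : nat) w f : map val w = iota p r ->
  (forall x, p <= x < p + r -> f x = f x.+1 + (j + c * (x.+1 == p + r)))%N ->
  (pi_word w 'X_[expnt f]).@[fun=> 1] = (slack_count j r c)%:Z.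
Proof.
elim: r c w f => [|r IHr] c w f.
  case: w => // _ _; rewrite /= mevalX big1 // => x _; exact: expr1n.
rewrite -addn1 iotaD cats1; case/lastP: w => [|w i].
  by move/(congr1 size); rewrite size_rcons.
rewrite map_rcons addn1 => /rcons_inj[eq_w eq_i] fE.
rewrite /pi_word foldr_rcons -/(pi_word _ _) (@pi_monomial _ _ (j + c));
  last first.
  by rewrite eq_i fE ?addnS ?eqxx; lia.
rewrite pi_word_sum raddf_sum /= (big_morph Posz PoszD (erefl 0%:Z)).
apply: eq_bigr => k _; apply: IHr => // x hx; rewrite /transfer eq_i.
have ltk := ltn_ord k.
have fpr : f (p + r) = (f (p + r).+1 + (j + c))%N.
  by rewrite [LHS]fE; [rewrite addnS eqxx muln1 | lia].
have fx : f x = (f x.+1 + j)%N.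
  rewrite fE; last lia.
  by have -> : (x.+1 == p + r.+1)%N = false; [lia | rewrite muln0 addn0].
have -> : (x == p + r)%N = false by lia.
have -> : (x == (p + r).+1)%N = false by lia.
have -> : (x.+1 == (p + r).+1)%N = false by lia.
(* This makes the truncated subtraction in [transfer] exact. *)
have le_k : (k <= f (p + r))%N by rewrite fpr; lia.
rewrite fx; case: (x.+1 =P p + r)%N => [->|_] /=; rewrite ?muln1 ?muln0 ?addn0 //.
by rewrite [(j + k)%N]addnC addnA subnK.
Qed.

End DividedDifferences.

Lemma key_at_ones_cycle_down n j : (0 < n)%N ->
  key_at_ones (cycle_down n) j = (slack_count j n.-1 0)%:Z.
Proof.
move=> n_gt0; have [eq_w _] := reduced_word_cycle_down n_gt0.
rewrite /key_at_ones /key /pi_perm.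
have -> : (delta n *+ j)%MM = expnt n (fun x => (n.-1 - x) * j)%N.
  by apply/mnmP => x; rewrite mulmnE !mnmE.
apply: (pi_word_down eq_w) => x hx; rewrite mul0n addn0 -mulSnr.
by congr muln; lia.
Qed.

Lemma key_at_ones_cycle_up n j : (0 < n)%N ->
  key_at_ones (cycle_up n) j = (slack_count j n.-1 0)%:Z.
Proof.
move=> n_gt0; have [eq_w _] := reduced_word_cycle_up n_gt0.
rewrite /key_at_ones /key /pi_perm.
have -> : (delta n *+ j)%MM = expnt n (fun x => (n.-1 - x) * j)%N.
  by apply/mnmP => x; rewrite mulmnE !mnmE.
apply: (pi_word_up eq_w) => x hx; rewrite mul0n addn0 -mulSnr.
by congr muln; lia.
Qed.

(** * Numerators of rational generating functions *)

Section Numerators.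

Implicit Types (a b : nat -> int) (P : {poly int}).

Lemma is_numerator_poly P : is_numerator (fun k => P`_k) 0 P.
Proof.
move=> k; rewrite expr0 (bigD1 ord0) //= coef1 mul1r subn0 big1 ?addr0 // => i.
by rewrite -val_eqE /= coef1 => /negPf ->; rewrite mul0r.
Qed.

(** Multiplying a series by 1 - t takes backward differences of its coefficients, with the
    coefficient of index -1 read as 0. *)
Lemma is_numeratorS a d P :
  is_numerator (fun k => a k - (if k is k'.+1 then a k' else 0)) d P ->
  is_numerator a d.+1 P.
Proof.
move=> numP k; rewrite -(numP k) exprS.
set Q := (1 - 'X) ^+ d.
under [RHS]eq_bigr => i _ do rewrite mulrBr.
rewrite [RHS]sumrB [in X in _ = _ - X]big_ord_recr /= subnn mulr0 addr0.
under eq_bigr => i _ do rewrite mulrBl mul1r coefB coefXM mulrBl.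
rewrite sumrB; congr (_ - _).
rewrite big_ord_recl /= mul0r add0r; apply: eq_bigr => i _.
have -> : (k - i = (k - i.+1).+1)%N by have := ltn_ord i; lia.
by rewrite add0n.
Qed.

Lemma is_numerator_sum (I : finType) (A : pred I) (a : I -> nat -> int) d
    (P : I -> {poly int}) : (forall x, A x -> is_numerator (a x) d (P x)) ->
  is_numerator (fun k => \sum_(x | A x) a x k) d (\sum_(x | A x) P x).
Proof.
move=> numP k; rewrite coef_sum.
under eq_bigr => i _ do rewrite mulr_sumr.
by rewrite exchange_big; apply: eq_bigr => x Ax; exact: numP.
Qed.

Lemma eq_is_numerator a b d P : a =1 b -> is_numerator a d P ->
  is_numerator b d P.
Proof.
by move=> eq_ab numP k; rewrite -numP; apply: eq_bigr => i _; rewrite eq_ab.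
Qed.

(** By Pascal's rule, the backward difference lowers [m] by one. The case k < e is separate because
    truncated subtraction would give 1 there instead of 0. *)
Lemma is_numerator_bin m e :
  is_numerator (fun k => if (k < e)%N then 0 else 'C(k - e + m, m)%:Z) m.+1 'X^e.
Proof.
elim: m => [|m IHm]; apply: is_numeratorS.
  apply: eq_is_numerator (is_numerator_poly _) => k; rewrite coefXn.
  case: k => [|k]; first by case: e => //= e; rewrite bin0.
  by rewrite !bin0; do ![case: ifP => //=]; case: eqP => //=; lia.
apply: eq_is_numerator IHm => -[|k].
  by case: ifP => // _; rewrite subr0 sub0n !add0n !binn.
case: ifP => [lt_k|ge_k]; first by rewrite ltnW ?subr0.
case: ifP => [lt_k|ge_k'].
  by have -> : (k.+1 - e = 0)%N; [lia|rewrite !add0n !binn subr0].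
have -> : (k.+1 - e = (k - e).+1)%N by lia.
by rewrite !addSn !addnS binS PoszD; ring.
Qed.

End Numerators.

Local Close Scope ring_scope.

(** * Reindexing sums over tuples and intervals *)

Lemma sum_tuple_cons (T : finType) m (F : seq T -> nat) :
  \sum_(t : m.+1.-tuple T) F t = \sum_x \sum_(t : m.-tuple T) F (x :: t).
Proof.
rewrite pair_big /=.
rewrite (reindex (fun p : T * m.-tuple T => [tuple of p.1 :: p.2])) //=.
exists (fun t : m.+1.-tuple T => (thead t, [tuple of behead t])) => [[x t] _|t _].
  by congr pair; apply: val_inj.
by rewrite /= -tuple_eta.
Qed.

Lemma sum_tuple0 (T : finType) (F : seq T -> nat) :
  \sum_(t : 0.-tuple T) F t = F [::].
Proof.
by rewrite (bigD1 [tuple]) //= big1 ?addn0 // => t /eqP[]; exact: tuple0.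
Qed.

Lemma sum_tuple_pair (T U : finType) m (F : seq T -> seq U -> nat) :
  \sum_(t : m.-tuple (T * U)) F (unzip1 t) (unzip2 t) =
  \sum_(u : m.-tuple U) \sum_(t : m.-tuple T) F t u.
Proof.
elim: m F => [|m IHm] F.
  rewrite (sum_tuple0 (fun t => F (unzip1 t) (unzip2 t))).
  by rewrite (sum_tuple0 (fun u => \sum_(t : 0.-tuple T) F t u))
    (sum_tuple0 (F^~ [::])).
rewrite (sum_tuple_cons _ (fun t => F (unzip1 t) (unzip2 t))).
rewrite (sum_tuple_cons _ (fun u => \sum_(t : m.+1.-tuple T) F t u)).
rewrite -(pair_big xpredT xpredT (fun x y => \sum_(t : m.-tuple (T * U))
  F (x :: unzip1 t) (y :: unzip2 t))) exchange_big /=.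
apply: eq_bigr => y _.
under eq_bigr => x _ do rewrite (IHm (fun t u => F (x :: t) (y :: u))).
rewrite exchange_big /=; apply: eq_bigr => u _.
by rewrite (sum_tuple_cons _ (fun t => F t (y :: u))).
Qed.

(** The substitution k = hi - 1 - g measures the distance to the top of the window; both sides
    vanish when the window is empty. *)
Lemma sum_window (M lo hi : nat) (F : nat -> nat) : hi <= M ->
  \sum_(g < M) (lo <= g < hi) * F (hi.-1 - g) = \sum_(k < hi - lo) F k.
Proof.
move=> le_hi.
rewrite -(big_mkord xpredT (fun g => (lo <= g < hi) * F (hi.-1 - g))).
have [le_lo|gt_lo] := leqP lo hi; last first.
  have -> : hi - lo = 0 by lia.
  by rewrite big_ord0 big1 // => g _; case: andP => //; lia.
rewrite (@big_cat_nat _ _ _ lo) //=; last exact: leq_trans le_hi.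
rewrite (@big_cat_nat _ _ _ hi lo M) //=.
rewrite big_nat big1 => [|g]; last by case: andP => //; lia.
rewrite [X in _ + (_ + X)]big_nat [X in _ + (_ + X)]big1 => [|g]; last first.
  by case: andP => //; lia.
rewrite add0n addn0 big_nat_rev /= -{1}[lo]add0n big_addn.
rewrite -(big_mkord xpredT F) big_nat [RHS]big_nat; apply: eq_bigr => k hk.
have -> : (lo <= lo + hi - (k + lo).+1 < hi) = true by lia.
by rewrite mul1n; congr F; lia.
Qed.

Lemma sum_mixed_radix (q m : nat) (F : nat -> nat) :
  \sum_(z : 'I_q * 'I_m) F (z.2 * q + z.1) = \sum_(k < m * q) F k.
Proof.
rewrite -(pair_big xpredT xpredT 
  (fun (f : 'I_q) (a : 'I_m) => F (a * q + f))) exchange_big /=.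
elim: m => [|m IHm]; first by rewrite !big_ord0.
rewrite big_ord_recr /= IHm -!(big_mkord xpredT F) mulSnr.
rewrite (@big_cat_nat _ _ _ (m * q) 0 (m * q + q)) ?leq_addr //=; congr addn.
rewrite -{2}[m * q]add0n big_addn addKn big_mkord; apply: eq_bigr => k _.
by rewrite addnC.
Qed.

(** * Counting subsets through strictly sorted listings *)

Section SortedByKey.

Variables (T : finType) (P : pred (seq T)).
Hypothesis perm_P : forall s t, perm_eq s t -> P s = P t.

Lemma sorted_keyE (k : T -> nat) s : injective k ->
  sorted (relpre k ltn) s = uniq s && sorted (relpre k leq) s.
Proof.
by move=> injk; rewrite -!sorted_map ltn_sorted_uniq_leq map_inj_uniq.
Qed.

(** Re-sorting by [k2] is injective on the tuples strictly sorted by [k1], since such a tuple is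
    determined by its set of elements; [P] survives as it ignores order. Exchanging the keys then
    gives equality. *)
Lemma leq_sum_sorted (k1 k2 : T -> nat) m : injective k1 -> injective k2 ->
  \sum_(t : m.-tuple T) (sorted (relpre k1 ltn) t && P t) <=
  \sum_(t : m.-tuple T) (sorted (relpre k2 ltn) t && P t).
Proof.
move=> inj1 inj2.
pose S (k : T -> nat) := [set t : m.-tuple T | sorted (relpre k ltn) t && P t].
have cardE k : \sum_(t : m.-tuple T) (sorted (relpre k ltn) t && P t) = #|S k|.
  by rewrite -big_mkcond sum1_card cardsE.
rewrite !cardE; pose h (t : m.-tuple T) := [tuple of sort (relpre k2 leq) t].
have tot k : total (relpre k leq) by move=> x y; exact: leq_total.
rewrite -(card_in_imset (f := h)) ?subset_leq_card //.
  apply/subsetP => _ /imsetP[t + ->]; rewrite !inE !sorted_keyE //.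
  case/andP => /andP[uniq_t _] Pt.
  by rewrite sort_uniq uniq_t sort_sorted // (perm_P (permEl (perm_sort _ _))).
move=> t u; rewrite !inE => /andP[st _] /andP[su _] /(congr1 val) /= eq_tu.
apply: val_inj; apply: (@irr_sorted_eq _ (relpre k1 ltn)) => //.
- by move=> y x z; exact: ltn_trans.
- by move=> x; exact: ltnn.
apply: perm_mem.
by rewrite -(perm_sort (relpre k2 leq) t u) eq_tu perm_sort.
Qed.

Lemma eq_sum_sorted (k1 k2 : T -> nat) m : injective k1 -> injective k2 ->
  \sum_(t : m.-tuple T) (sorted (relpre k1 ltn) t && P t) =
  \sum_(t : m.-tuple T) (sorted (relpre k2 ltn) t && P t).
Proof.
by move=> inj1 inj2; apply/eqP; rewrite eqn_leq !leq_sum_sorted.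
Qed.

End SortedByKey.

(** * Listings ordered by first coordinate *)

Lemma des_cons2 x y a : des (x :: y :: a) = (y < x) + des (y :: a).
Proof.
rewrite /des /= -[1]addn0 iotaDl count_map; congr addn.
Qed.

Lemma des_cons_le x a : des (x :: a) <= size a.
Proof. by rewrite /des (leq_trans (count_size _ _)) // size_iota. Qed.

(** Hockey-stick identity; [d <= s] makes the right-hand side vanish at r = 0. *)
Lemma sum_bin_diag s d r : d <= s ->
  \sum_(k < r) 'C(k + d, s) = 'C(r + d, s.+1).
Proof.
move=> le_ds; elim: r => [|r IHr]; first by rewrite big_ord0 bin_small.
by rewrite big_ord_recr /= IHr addSn binS.
Qed.

(** Both keys encode lexicographic orders in mixed radix. For second coordinates at most [m],
    [key_fst] compares first coordinates and breaks ties by decreasing second ones; for first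
    coordinates below [q], [key_snd] compares second coordinates, then first ones. *)
Definition key_fst m (z : nat * nat) : nat := z.1 * m.+1 + (m - z.2).
Definition key_snd q (z : nat * nat) : nat := z.2 * q + z.1.

Lemma key_fst_lt m f g x y : x <= m -> y <= m ->
  (key_fst m (f, x) < key_fst m (g, y)) = (f + (x <= y) <= g).
Proof.
rewrite /key_fst /= => lex ley.
by apply/idP/idP; case: leqP => /=; nia.
Qed.

(** By [key_fst_lt], the next first coordinate g may equal f exactly at a descent. A descent thus
    lengthens the window for g by one, and [sum_bin_diag] sums the inductive counts over that
    window. *)
Lemma sum_path_key_fst q m f x a : f < q -> x <= m -> all (leq^~ m) a ->
  \sum_(t : (size a).-tuple 'I_q)
    path (relpre (key_fst m) ltn) (f, x) (zip (map val t) a) =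
  'C(q - f.+1 + des (x :: a), size a).
Proof.
elim: a f x => [|y a IHa] f x ltf lex.
  by rewrite (sum_tuple0 (fun t => path _ _ (zip (map val t) _) : nat)) bin0.
case/andP => ley lea.
rewrite (sum_tuple_cons _ (fun t => path _ _ (zip (map val t) _) : nat)) /=.
under eq_bigr => g _.
  under eq_bigr => t _ do rewrite key_fst_lt // -mulnb.
  rewrite -big_distrr IHa //=.
  have -> : (f + (x <= y) <= g) = (f + (x <= y) <= g < q) by rewrite ltn_ord andbT.
  have -> : q - g.+1 = q.-1 - g by have := ltn_ord g; lia.
  over.
rewrite (sum_window _ (fun k => 'C(k + des (y :: a), size a))) //.
rewrite sum_bin_diag ?des_cons_le // des_cons2; congr 'C(_, _).
by case: leqP => /=; lia.
Qed.

Lemma sum_sorted_key_fst q m s a : size a = s -> all (leq^~ m) a ->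
  \sum_(t : s.-tuple 'I_q)
    sorted (relpre (key_fst m) ltn) (zip (map val t) a) =
  'C(q + des a, s).
Proof.
move=> <-; case: a => [|y a] lea.
  by rewrite (sum_tuple0 (fun t => sorted _ (zip (map val t) _) : nat)) bin0.
case/andP: lea => ley lea.
rewrite (sum_tuple_cons _ (fun t => sorted _ (zip (map val t) _) : nat)) /=.
pose F k := 'C(k + des (y :: a), size a).
rewrite (eq_bigr (fun g : 'I_q => (0 <= g < q) * F (q.-1 - g))); last first.
  move=> g _; rewrite sum_path_key_fst // ltn_ord mul1n.
  by rewrite /F -subn1 -subnDA add1n.
rewrite (sum_window _ F) // subn0.
by rewrite sum_bin_diag ?des_cons_le.
Qed.

(** * Listings ordered by second coordinate *)

Fixpoint staircase (s : nat) (a : seq nat) : bool :=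
  if a is x :: a' then (0 < x <= s.+1) && staircase s.+1 a' else true.

(** The offset [s] is the number of entries already read, so [staircase 0] bounds the i-th entry by
    i. *)
Lemma staircaseE s a : staircase s a =
  all (leq 1) a && all (fun i => nth 0 a i <= s + i.+1) (iota 0 (size a)).
Proof.
elim: a s => [//|x a IHa] s /=.
rewrite IHa -[1]addn0 iotaDl all_map addn1.
rewrite (eq_all (a1 := preim _ _) (a2 := fun i => nth 0 a i <= s.+1 + i.+1)).
  by case: (0 < x); case: (x <= _); case: (all (leq 1) a).
by move=> i /=; rewrite add1n addSnnS.
Qed.

Lemma is_parking_sorted a : sorted leq a -> is_parking a = staircase 0 a.
Proof.
by move=> sa; rewrite /is_parking staircaseE sorted_sort //; exact: leq_trans.
Qed.

Lemma mixed_radix_inj q f g x y : f < q -> g < q ->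
  x * q + f = y * q + g -> x = y /\ f = g.
Proof.
move=> ltf ltg eq_xy; have q_gt0 : 0 < q by lia.
have eq_x := congr1 (divn^~ q) eq_xy; have eq_f := congr1 (modn^~ q) eq_xy.
by move: eq_x eq_f; rewrite /= !divnMDl // !modnMDl !divn_small ?modn_small ?addn0.
Qed.

Definition nat_pair q m (z : 'I_q * 'I_m) : nat * nat := (val z.1, val z.2).

(** Elements with second coordinate 0 have key at most q - 1, so the lower bound on the key already
    excludes them; the upper bound on the second coordinate is one on the key. *)
Lemma key_snd_step q s m k0 (z : 'I_q * 'I_m) : q.-1 <= k0 ->
  (k0 < key_snd q (nat_pair z)) && (0 < z.2 <= s.+1) =
  (k0 < key_snd q (nat_pair z) < s.+2 * q).
Proof.
case: z => f x /=; rewrite /key_snd /= => le_k0; have := ltn_ord f => ltf.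
have -> : (x <= s.+1) = (x * q + f < s.+2 * q).
  apply/idP/idP => [lex|]; first by have := leq_mul lex (leqnn q); lia.
  by apply: contraTT; rewrite -!ltnNge => gtx; have := leq_mul gtx (leqnn q); lia.
case: ltnP => //= lt_k; case: posnP lt_k => // ->; lia.
Qed.

(** Here [k0] is the last key used and the third argument of [slack_count] is its distance c to the
    largest key allowed at that stage. The next bound is j + 1 higher and the key must grow, so the
    new slack ranges over 0, ..., j + c. *)
Lemma sum_path_key_snd j m r s k0 : j <= k0 < s.+1 * j.+1 -> s + r <= m ->
  \sum_(t : r.-tuple ('I_j.+1 * 'I_m.+1))
    (path ltn k0 (map (key_snd j.+1 \o @nat_pair _ _) t) &&
     staircase s (map (fun z => nat_of_ord z.2) t)) =
  slack_count j r ((s.+1 * j.+1).-1 - k0).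
Proof.
elim: r s k0 => [|r IHr] s k0 hk0 le_m.
  by rewrite (sum_tuple0 (fun t => path ltn k0 (map _ t) && _ (map _ t) : nat)).
rewrite (sum_tuple_cons _ (fun t => path ltn k0 (map _ t) && _ (map _ t) : nat)) /=.
pose F k := (k0 < k < s.+2 * j.+1) *
  slack_count j r ((s.+2 * j.+1).-1 - k).
rewrite (eq_bigr (fun z : 'I_j.+1 * 'I_m.+1 => F (z.2 * j.+1 + z.1))); last first.
  move=> z _; rewrite /F -[z.2 * _ + _]/(key_snd j.+1 (nat_pair z)).
  have hk0j : j.+1.-1 <= k0 by lia.
  under eq_bigr => t _ do rewrite andbACA (key_snd_step _ _ hk0j) -mulnb.
  rewrite -big_distrr /=; case: andP => [[lt1 lt2]|_]; last by rewrite !mul0n.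
  by rewrite IHr //; lia.
(* The bound [s + r <= m] keeps the whole window below the number of available keys. *)
rewrite sum_mixed_radix /F sum_window; last by nia.
by have -> : (j + ((s.+1 * j.+1).-1 - k0)).+1 = s.+2 * j.+1 - k0.+1 by lia.
Qed.

(** Double counting: the two sides arise from listing the same subsets by [kf] and by [ks]. *)
Lemma sum_parking_bin j m :
  \sum_(a in PF m) 'C(j.+1 + des (map val a), m) = slack_count j m 0.
Proof.
pose kf (z : 'I_j.+1 * 'I_m.+1) := key_fst m (nat_pair z).
pose ks (z : 'I_j.+1 * 'I_m.+1) := key_snd j.+1 (nat_pair z).
pose snds := map (fun z : 'I_j.+1 * 'I_m.+1 => nat_of_ord z.2).
pose P s := is_parking (snds s).
have kf_inj : injective kf.
  move=> [f x] [g y] /mixed_radix_inj[]; rewrite ?ltnS ?leq_subr //= => fg xy.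
  have := ltn_ord x; have := ltn_ord y => lty ltx.
  by congr pair; apply: val_inj => /=; lia.
have ks_inj : injective ks.
  move=> [f x] [g y] /mixed_radix_inj[] //= xy fg.
  by congr pair; apply: val_inj.
have perm_P s t : perm_eq s t -> P s = P t.
  move=> /(perm_map (fun z => nat_of_ord z.2)) st.
  rewrite /P /is_parking (perm_all _ st).
  by rewrite (perm_size st) (perm_sortP leq_total leq_trans anti_leq _ _ st).
transitivity (\sum_(t : m.-tuple ('I_j.+1 * 'I_m.+1))
    (sorted (relpre kf ltn) t && P t)).
  rewrite big_mkcond /=.
  pose G (t : seq 'I_j.+1) (a : seq 'I_m.+1) : nat :=
    sorted (relpre (key_fst m) ltn) (zip (map val t) (map val a)) &&
    is_parking (map val a).
  rewrite (eq_bigr (fun t : m.-tuple _ => G (unzip1 t) (unzip2 t))); last first.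
    move=> t _; rewrite /G /P -!map_comp.
    rewrite (_ : zip _ _ = map (@nat_pair _ _) t) ?sorted_map //.
    by elim: (val t) => //= z s ->.
  rewrite sum_tuple_pair; apply: eq_bigr => a _; rewrite /G inE.
  under eq_bigr => t _ do rewrite andbC -mulnb.
  rewrite -big_distrr /=; case: (is_parking _); last by rewrite mul0n.
  rewrite mul1n sum_sorted_key_fst ?size_map ?size_tuple //.
  by apply/allP => _ /mapP[x _ ->]; rewrite -ltnS ltn_ord.
rewrite (eq_sum_sorted perm_P _ kf_inj ks_inj).
(* The starting key j is the largest one with second coordinate 0, so the initial slack is 0. *)
have := @sum_path_key_snd j m m 0 j; rewrite mul1n subnn => <- //; last lia.
apply: eq_bigr => t _; congr nat_of_bool.
have sorted_snd s : sorted (relpre ks ltn) s -> P s = staircase 0 (snds s).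
  move=> sorted_s; apply: is_parking_sorted; rewrite sorted_map.
  apply: sub_sorted sorted_s => -[f x] [g y]; rewrite /ks /key_snd /=.
  have := ltn_ord f; have := ltn_ord g => ltg ltf.
  by case: (leqP x y) => // ltyx; have := leq_mul ltyx (leqnn j.+1); lia.
rewrite -[X in path _ _ X]/(map ks t) -/(snds t).
(* The staircase condition makes the first second coordinate positive, so its key exceeds j and the
   extra comparison is automatic. *)
have -> : path ltn j (map ks t) && staircase 0 (snds t) =
    sorted (relpre ks ltn) t && staircase 0 (snds t).
  rewrite -sorted_map; case: (val t) => //= -[f x] s /=.
  case: posnP => [->|x_gt0]; rewrite ?andbF //.
  by rewrite /ks /key_snd /=; case: ltnP => //; nia.
by case: (boolP (sorted _ _)) => // /sorted_snd ->.
Qed.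

Local Open Scope ring_scope.

(** * From counts to generating functions *)

Lemma parking_numerator m : (0 < m)%N ->
  is_numerator (fun j => (slack_count j m 0)%:Z) m.+1 (parking_poly m).
Proof.
move=> m_gt0.
apply: eq_is_numerator (is_numerator_sum (a := fun (a : m.-tuple 'I_m.+1) j =>
    'C(j.+1 + des (map val a), m)%N%:Z) _) => [j|a _].
  by rewrite -sum_parking_bin (big_morph Posz PoszD (erefl 0%:Z)).
apply: eq_is_numerator (is_numerator_bin m _) => j.
have : (des (map val a) <= m.-1)%N.
  by rewrite /des (leq_trans (count_size _ _)) // size_iota size_map size_tuple.
(* With e = m - 1 - des, the binomial vanishes for j < e because j + 1 + des < m; otherwise j + 1 +
   des = j - e + m. *)
move=> le_des; case: ifP => lt_j; first
  by rewrite bin_small; move: lt_j le_des => /=; lia.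
congr (Posz (binomial _ _)); move: lt_j le_des => /=; lia.
Qed.

Theorem theorem1p2 (n : nat) (hn : (2 <= n)%N) :
  is_E (cycle_down n) (parking_poly n.-1) /\
  is_E (cycle_up n) (parking_poly n.-1).
Proof.
have n_gt0 : (0 < n)%N by lia.
have num : is_numerator (fun j => (slack_count j n.-1 0)%:Z) n.-1.+1
    (parking_poly n.-1) by apply: parking_numerator; lia.
have [_ len_down] := reduced_word_cycle_down n_gt0.
have [_ len_up] := reduced_word_cycle_up n_gt0.
split; rewrite /is_E ?len_down ?len_up; apply: eq_is_numerator num => j.
  by rewrite key_at_ones_cycle_down.
by rewrite key_at_ones_cycle_up.
Qed.
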